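(* Let $(E_i(0),\,i\in\mathcal S)$ be any initial energy configuration with $0\le E_i(0)\le\overline E_i$. Let $\mathcal S'=\{i\in\mathcal S:E_i(0)<\overline E_i\}$ and $u_0=\min_{i\in\mathcal S'}E_i(0)/P_i$ (with $u_0=\infty$ if $\mathcal S'=\emptyset$). Let $\mathcal S_1=\{i\in\mathcal S:\overline E_i/P_i\le u_0\}$, $\mathcal S_2=\mathcal S\setminus\mathcal S_1$, and $k=\sum_{i\in\mathcal S_2}P_i$. Let $T>0$ and let $(d(t),\,t\in[0,T])$ be a nonnegative, integrable, weakly increasing demand function with $d(0)\ge k$. If some cross-charging policy completely serves $d$ on $[0,T]$ from this initial configuration, then $d$ can also be completely served on $[0,T]$ from this initial configuration by a policy without cross-charging.
   Context: A finite set $\mathcal S$ of energy stores is given. Store $i\in\mathcal S$ has capacity $\overline E_i>0$, maximum discharge rate $P_i>0$, maximum charge rate $P'_i\ge0$ and round-trip efficiency $\eta_i\in(0,1]$. A cross-charging policy is a choice of measurable rate functions $(r_i(t),\,t\ge0)$ with $E_i(t)=E_i(0)-\int_0^t r_i(u)\,du$, subject to $0\le E_i(t)\le\overline E_i$, $-P'_i\le r_i(t)\le P_i$, and $$0\le\sum_{i:\,r_i(t)\ge0}r_i(t)+\sum_{i:\,r_i(t)<0}r_i(t)/\eta_i\le d(t)\quad\text{for all }t$$ (negative $r_i$ means store $i$ is charged, drawing energy at rate $-r_i/\eta_i$ from other stores; no external energy is available). It completely serves $d$ on an interval $I$ if the middle expression equals $d(t)$ for almost every $t\in I$. A policy with all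 $r_i(t)\ge0$ is one without cross-charging. *)

(* Defs.v *)
From HB Require Import structures.
From mathcomp Require Import all_boot all_order all_algebra.
From mathcomp Require Import all_classical all_reals all_analysis.
Set Implicit Arguments. Unset Strict Implicit. Unset Printing Implicit Defensive.
Import Order.TTheory GRing.Theory Num.Theory.
Local Open Scope classical_set_scope.
Local Open Scope ring_scope.

Section Stores.
Variables (R : realType) (S : finType).
Variables (Ebar P P' eta E0 : S -> R).

Definition Sprime : {set S} := [set i | E0 i < Ebar i].

Definition u0 : \bar R :=
  \big[Order.min/+oo%E]_(i in Sprime) ((E0 i / P i)%:E).

Definition S1 : {set S} := [set i | ((Ebar i / P i)%:E <= u0)%E].
Definition S2 : {set S} := ~: S1.
Definition kS : R := \sum_(i in S2) P i.

Definition energy (r : S -> R -> R) (i : S) (t : R) : R :=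
  E0 i - Rintegral lebesgue_measure `[0, t] (r i).

Definition supplied (r : S -> R -> R) (t : R) : R :=
  \sum_(i : S) (if 0 <= r i t then r i t else r i t / eta i).

Definition policy (T : R) (d : R -> R) (r : S -> R -> R) : Prop :=
  (forall i, measurable_fun `[0, T] (r i)) /\
  (forall t, 0 <= t <= T ->
     (forall i, 0 <= energy r i t <= Ebar i /\ - P' i <= r i t <= P i) /\
     0 <= supplied r t <= d t).

Definition completely_serves (T : R) (d : R -> R) (r : S -> R -> R) : Prop :=
  {ae lebesgue_measure, forall t : R, 0 <= t <= T -> supplied r t = d t}.

Definition no_cross_charging (T : R) (r : S -> R -> R) : Prop :=
  forall i t, 0 <= t <= T -> 0 <= r i t.

End Stores.

(* Main.v *)
Require Import Defs.
From HB Require Import structures.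
From mathcomp Require Import all_boot all_order all_algebra.
From mathcomp Require Import all_classical all_reals all_analysis.
From mathcomp Require Import measurable_realfun.
From mathcomp Require Import ring lra.
Import Order.TTheory GRing.Theory Num.Theory.
Import numFieldNormedType.Exports.
Local Open Scope classical_set_scope.
Local Open Scope ring_scope.

(** A weakly increasing demand [d] on [[0, T]] can be served without
cross-charging iff, for all [t], the energy demanded on [[t, T]] is at most
[\sum_i Num.min (E0 i) (P i * (T - t))], the most the stores can discharge
in a time [T - t].

Sufficiency: let one store serve the horizontal slice of the demand between
the levels [c] and [c + P], with [c] chosen so that the store is exactly
exhausted at [T] ([c = 0] if it cannot be exhausted). The residual demand is
still increasing. The condition for the remaining stores clearly holds at the
times [t] at which [d t] is outside the slice; in between, the residual demand
is the constant [c], and concavity of the right-hand side in [t] gives the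
condition by interpolation. Induct on the number of stores.

Necessity, even with cross-charging, when [k <= d 0]: over [[t, T]] a policy
delivers at most [\sum_i Num.min (E_i t) (P i * (T - t))]. If [T - t <= u0], then this is at
most the bound with [E0], because the stores which are not initially full have
[P i * (T - t) <= E0 i]. If [T - t > u0], then decreasing [t] increases the
bound at a rate at most [k], since the stores in [S1] no longer contribute,
while the demand increases at a rate at least [k]; so the condition at [t]
follows from that at [0], where [E_i 0 = E0 i]. *)

Local Notation mu := lebesgue_measure.
Local Notation integ a b f := (Rintegral mu `[a, b] f).
Local Notation integrable_on a b f := (mu.-integrable `[a, b] (EFin \o f)).

(** * Integrals of real functions over compact intervals *)

Section Integral.
Context {R : realType}.
Implicit Types (a b c t M : R) (f g : R -> R).

Lemma integrable_on_sub a b c e f : a <= c -> e <= b ->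
  integrable_on a b f -> integrable_on c e f.
Proof.
move=> ac eb; apply: integrableS => //.
by apply: subset_itvScc; rewrite bnd_simp.
Qed.

Lemma integrable_on_bounded {a b f} (M : R) : measurable_fun `[a, b] f ->
  (forall t, a <= t <= b -> - M <= f t <= M) -> integrable_on a b f.
Proof.
move=> mf fM; apply: measurable_bounded_integrable => //.
  by rewrite /= lebesgue_measure_itv/=; case: ifP => _; rewrite ltry.
exists M; split; first exact: num_real.
move=> x Mx t /=; rewrite in_itv/= ler_norml => /fM/andP[Mf fx].
by rewrite (le_trans fx (ltW Mx)) (le_trans _ Mf)// lerN2 ltW.
Qed.

Lemma integ_cat a b c f : a <= b <= c -> integrable_on a c f ->
  integ a c f = integ a b f + integ b c f.
Proof.
move=> /andP[ab bc] fi.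
have := @Rintegral_itvB _ _ (BLeft a) (BRight c) b fi.
rewrite !bnd_simp => /(_ ab bc).
rewrite Rintegral_itv_obnd_cbnd => [<-|]; first by rewrite addrC subrK.
by apply: integrableS fi => //; apply: subset_itvr; rewrite bnd_simp.
Qed.

(** Endpoints are null. This matters because a monotone demand is not controlled at the very point
    where it crosses a level. *)
Lemma eq_integ_oo a b f g : integrable_on a b f -> integrable_on a b g ->
  (forall t, a < t < b -> f t = g t) -> integ a b f = integ a b g.
Proof.
have E h : integrable_on a b h ->
    integ a b h = Rintegral mu `]a, b[ h.
  move=> hi; rewrite -Rintegral_itv_obnd_cbnd ?Rintegral_itv_bndo_bndc//;
    by apply: integrableS hi => //; apply: subset_itv; rewrite bnd_simp.
move=> fi gi fg; rewrite !E//; apply: eq_Rintegral => t.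
by rewrite inE/= in_itv/=; exact: fg.
Qed.

Lemma integ_cst a b c : a <= b -> integ a b (cst c) = c * (b - a).
Proof.
move=> ab; rewrite Rintegral_cst//= lebesgue_measure_itv/= lte_fin.
case: ltP => //= ba; have -> : b = a by apply/eqP; rewrite eq_le ba.
by rewrite subrr.
Qed.

Lemma integrable_on_cst a b c : integrable_on a b (cst c).
Proof.
by apply: (@integrable_on_bounded _ _ _ `|c|) => // t _; rewrite -ler_norml.
Qed.

Lemma le_integ a b f g : integrable_on a b f -> integrable_on a b g ->
  (forall t, a <= t <= b -> f t <= g t) -> integ a b f <= integ a b g.
Proof.
by move=> fi gi fg; apply: le_Rintegral => // t /=; rewrite in_itv; exact: fg.
Qed.

Lemma integ_eq_cst c a b f : a <= b -> integrable_on a b f ->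
  (forall t, a < t < b -> f t = c) -> integ a b f = c * (b - a).
Proof.
move=> ab fi fc; rewrite -integ_cst//; apply: eq_integ_oo => //.
exact: integrable_on_cst.
Qed.

Lemma integ_le_cst c a b f : a <= b -> integrable_on a b f ->
  (forall t, a <= t <= b -> f t <= c) -> integ a b f <= c * (b - a).
Proof.
move=> ab fi fc; rewrite -integ_cst//; apply: le_integ => //.
exact: integrable_on_cst.
Qed.

Lemma integ_ge_cst c a b f : a <= b -> integrable_on a b f ->
  (forall t, a <= t <= b -> c <= f t) -> c * (b - a) <= integ a b f.
Proof.
move=> ab fi fc; rewrite -integ_cst//; apply: le_integ => //.
exact: integrable_on_cst.
Qed.

Lemma integ_point a f : integ a a f = 0.
Proof. by rewrite set_itv1 Rintegral_set1. Qed.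

Lemma integB a b f g : integrable_on a b f -> integrable_on a b g ->
  integ a b (f \- g) = integ a b f - integ a b g.
Proof. by move=> fi gi; rewrite RintegralB. Qed.

Lemma integrable_onB a b f g : integrable_on a b f -> integrable_on a b g ->
  integrable_on a b (f \- g).
Proof.
move=> fi gi; rewrite (_ : EFin \o _ = (EFin \o f) \- (EFin \o g))%E//.
exact: integrableB.
Qed.

Lemma integrable_on_sum {I : Type} (s : seq I) a b (f : I -> R -> R) :
  (forall i, integrable_on a b (f i)) ->
  integrable_on a b (fun t => \sum_(i <- s) f i t).
Proof.
move=> fi; rewrite (_ : EFin \o _ = fun t => (\sum_(i <- s) (f i t)%:E)%E).
  by apply: integrable_sum => //= i _; exact: fi.
by apply/funext => t /=; rewrite sumEFin.
Qed.

Lemma integ_sum {I : Type} (s : seq I) a b (f : I -> R -> R) :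
  (forall i, integrable_on a b (f i)) ->
  integ a b (fun t => \sum_(i <- s) f i t) = \sum_(i <- s) integ a b (f i).
Proof.
move=> fi; elim: s => [|i s IHs].
  rewrite big_nil (_ : (fun t => _) = cst 0) ?Rintegral_cst ?mul0r//.
  by apply/funext => t; rewrite big_nil.
rewrite big_cons -IHs -RintegralD//; last exact: integrable_on_sum.
by apply: eq_Rintegral => t _; rewrite big_cons.
Qed.

End Integral.

(** * Horizontal slices of an increasing demand *)

Section Slice.
Context {R : realType}.
Implicit Types (P E T c t x y : R) (d h : R -> R).

Definition nondecr_on T d := forall s t, 0 <= s -> s <= t -> t <= T -> d s <= d t.

(** The crossing point is a supremum. Nothing is claimed at [z] itself, where [d] may jump. *)
Lemma level_crossing T d c : 0 <= T -> nondecr_on T d ->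
  exists2 z : R, 0 <= z <= T &
    (forall t, 0 <= t < z -> d t <= c) /\ (forall t, z < t <= T -> c <= d t).
Proof.
(* Adjoining [0] keeps the set nonempty when [d] exceeds [c] throughout. *)
move=> T0 dm; pose A := [set 0] `|` [set t | 0 <= t <= T /\ d t <= c].
have A0 : A 0 by left.
have AT : ubound A T by move=> t [->//|[/andP[]]].
have sA : has_sup A by split; [exists 0 | exists T].
have s0 : 0 <= sup A by apply: ub_le_sup => //; exists T.
exists (sup A); first by rewrite s0 ge_sup//; exists 0.
split=> t /andP[].
  move=> t0 /(sup_gt (ex_intro _ _ A0))[v [->|[/andP[v0 vT] dv]] tv].
    by move: tv; rewrite ltNge t0.
  by apply: le_trans dv; exact: dm (ltW tv) vT.
move=> zt tT; rewrite leNgt; apply/negP => /ltW dt.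
suff /(lt_le_trans zt) : t <= sup A by rewrite ltxx.
apply: ub_le_sup; first by exists T.
by right; split=> //; rewrite tT andbT (le_trans s0 (ltW zt)).
Qed.

(** For [0 <= P], [clip P (d t - c)] is the part of the demand [d t] between the levels [c] and
    [c + P]. *)
Definition clip P x := Num.min P (Num.max 0 x).

Lemma clip_ge0 P x : 0 <= P -> 0 <= clip P x.
Proof. by move=> P0; rewrite /clip le_min P0 le_max lexx. Qed.

Lemma clip_le P x : clip P x <= P.
Proof. by rewrite /clip ge_min lexx. Qed.

Lemma clip_neg P x : 0 <= P -> x <= 0 -> clip P x = 0.
Proof. by move=> P0 x0; rewrite /clip max_l// min_r. Qed.

Lemma clip_large P x : 0 <= P -> P <= x -> clip P x = P.
Proof. by move=> P0 Px; rewrite /clip max_r ?min_l// (le_trans P0). Qed.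

Lemma clip_id P x : 0 <= x <= P -> clip P x = x.
Proof. by move=> /andP[x0 xP]; rewrite /clip max_r// min_r. Qed.

Lemma clip_le_id P x y : 0 <= y -> x <= y -> clip P x <= y.
Proof. by move=> y0 xy; rewrite /clip ge_min ge_max y0 xy orbT. Qed.

Lemma le_clip P x y : x <= y -> clip P x <= clip P y.
Proof. by rewrite /clip /Num.min /Num.max => xy; do !case: ifP => //=; lra. Qed.

(** Serves twice: for the continuity of the slice integral in [c], and for the monotonicity of the
    residual demand. *)
Lemma clip_le1 P x y : x <= y -> clip P y - clip P x <= y - x.
Proof. by rewrite /clip /Num.min /Num.max => xy; do !case: ifP => //=; lra. Qed.

Lemma measurable_clip (D : set R) P (f : R -> R) :
  measurable_fun D f -> measurable_fun D (fun t => clip P (f t)).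
Proof.
move=> mf; apply: measurable_minr; first exact: measurable_cst.
by apply: measurable_maxr => //; exact: measurable_cst.
Qed.

Lemma integrable_clip a b P d c : 0 <= P -> integrable_on a b d ->
  integrable_on a b (fun t => clip P (d t - c)).
Proof.
move=> P0 di; apply: (integrable_on_bounded P).
  apply: measurable_clip; apply: measurable_funB; last exact: measurable_cst.
  by apply/measurable_EFinP; exact: measurable_int di.
by move=> t _ /=; rewrite clip_le andbT (le_trans _ (clip_ge0 _ _ P0))// oppr_le0.
Qed.

Lemma lipschitz_continuous (k : R) (f : R -> R) :
  (forall x y, x <= y -> `|f y - f x| <= k * (y - x)) -> continuous f.
Proof.
move=> fk x; apply/cvgrPdist_le => e e0.
(* A positive Lipschitz constant, by which [e] can be divided even when [k] is [0]. *)
have K0 : 0 < `|k| + 1 by rewrite ltr_wpDl.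
near=> y.
have xy : `|x - y| <= e / (`|k| + 1).
  by near: y; apply: cvgr_dist_le => //; rewrite divr_gt0.
apply: (@le_trans _ _ ((`|k| + 1) * `|x - y|)); last first.
  by rewrite -ler_pdivlMl// mulrC.
have kk : k <= `|k| + 1 by rewrite (le_trans (ler_norm _))// lerDl.
have [yx|xy'] := leP y x.
  rewrite [X in _ * X]ger0_norm ?subr_ge0// (le_trans (fk _ _ yx))//.
  by rewrite ler_wpM2r// subr_ge0.
rewrite distrC [X in _ * X]distrC [X in _ * X]ger0_norm ?subr_ge0 ?(ltW xy')//.
by rewrite (le_trans (fk _ _ (ltW xy')))// ler_wpM2r// subr_ge0 ltW.
Unshelve. all: by end_near. Qed.

Lemma continuous_integ_clip T P d : 0 <= T -> 0 <= P -> integrable_on 0 T d ->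
  continuous (fun c => integ 0 T (fun t => clip P (d t - c))).
Proof.
move=> T0 P0 di; apply: (@lipschitz_continuous T) => x y xy.
rewrite distrC ger0_norm; last first.
  rewrite subr_ge0; apply: le_integ; try exact: integrable_clip.
  by move=> t _; apply: le_clip; lra.
rewrite -integB; try exact: integrable_clip.
rewrite -[X in X * _]subr0 mulrC; apply: integ_le_cst => //.
  by apply: integrable_onB; exact: integrable_clip.
move=> t _ /=; have := @clip_le1 P (d t - y) (d t - x); lra.
Qed.

Definition concave_on T h := forall x y z, 0 <= x -> x <= y -> y <= z -> z <= T ->
  (z - y) * h x + (y - x) * h z <= (z - x) * h y.

(** As [c] rises from [0] to [d T], the energy in the slice varies continuously and ends at [0]. If
    it starts above [E], some intermediate level gives exactly [E]. *)
Lemma exists_slice_level T d P E : 0 <= T -> 0 <= P -> 0 <= E ->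
    nondecr_on T d -> 0 <= d 0 -> integrable_on 0 T d ->
  exists2 c : R, 0 <= c & let w := integ 0 T (fun t => clip P (d t - c)) in
    w = E \/ c = 0 /\ w <= E.
Proof.
move=> T0 P0 E0 dm d0 di.
pose w c := integ 0 T (fun t => clip P (d t - c)).
have [wE|/ltW Ew] := leP (w 0) E; first by exists 0 => //; right.
have dT : 0 <= d T by rewrite (le_trans d0)//; exact: dm.
have wdT : w (d T) = 0.
  rewrite -(mul0r (T - 0)); apply: integ_eq_cst => //.
    exact: integrable_clip.
  move=> t /andP[t0 tT]; apply: clip_neg => //.
  by rewrite subr_le0; apply: dm => //; exact: ltW.
have [||c] := @IVT R w 0 (d T) E dT.
- by apply: continuous_subspaceT; exact: continuous_integ_clip.
- by rewrite wdT ge_min le_max E0 Ew orbT.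
- by rewrite in_itv/= => /andP[c0 _] wc; exists c => //; left.
Qed.

(** Peels off one store; [h] stands for the joint output bound of the remaining ones. *)
Lemma slice T d P E h : 0 <= T -> 0 <= P -> 0 <= E ->
    nondecr_on T d -> 0 <= d 0 -> integrable_on 0 T d ->
    nondecr_on T h -> concave_on T h ->
    (forall t, 0 <= t <= T ->
      integ t T d <= Num.min E (P * (T - t)) + h (T - t)) ->
  exists2 c : R, 0 <= c & let r := fun t => clip P (d t - c) in
    integ 0 T r <= E /\
    forall t, 0 <= t <= T -> integ t T (d \- r) <= h (T - t).
Proof.
move=> T0 P0 E0 dm d0 di hm hc dh.
have [c c0] := @exists_slice_level T d P E T0 P0 E0 dm d0 di.
set r := fun t => _ => /= wE; exists c => //=.
split; first by case: wE => [->|[]].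
have sub (f : R -> R) (a b : R) : 0 <= a -> b <= T ->
    integrable_on 0 T f -> integrable_on a b f.
  by move=> a0 bT; exact: integrable_on_sub.
have ri : integrable_on 0 T r by exact: integrable_clip.
have gi : integrable_on 0 T (d \- r) by exact: integrable_onB.
have dhE t : 0 <= t <= T -> integ t T d <= E + h (T - t).
  by move=> /dh /le_trans; apply; rewrite lerD2r ge_min lexx.
have dhP t : 0 <= t <= T -> integ t T d <= P * (T - t) + h (T - t).
  by move=> /dh /le_trans; apply; rewrite lerD2r ge_min lexx orbT.
have gE t : 0 <= t <= T -> integ t T (d \- r) = integ t T d - integ t T r.
  by move=> /andP[t0 tT]; rewrite integB//; exact: sub.
(* After [z2] the demand fills the slice, so the store runs at rate [P] and its term [P * (T - t)]
   cancels. *)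
have [z2 /andP[z20 z2T] [ltz2 gtz2]] := @level_crossing T d (c + P) T0 dm.
have high t : z2 <= t <= T -> integ t T (d \- r) <= h (T - t).
  move=> /andP[z2t tT].
  have t0 := le_trans z20 z2t.
  rewrite gE ?t0// (@integ_eq_cst _ P t T r)//; last 2 first.
  - exact: sub.
  - move=> u /andP[tu uT]; apply: clip_large => //.
    by rewrite lerBrDl; apply: gtz2; rewrite (le_lt_trans z2t tu) ltW.
  by rewrite lerBlDl dhP ?t0.
(* The case [c = 0] comes first: nothing lies below the slice, so the residual vanishes between [t]
   and [z2], and monotonicity of [h] carries the bound from [z2] back to [t]. *)
case: wE => [wE|[c00 wE]]; last first.
  move=> t /andP[t0 tT]; have [z2t|/ltW tz2] := leP z2 t.
    by apply: high; rewrite z2t.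
  rewrite (@integ_cat _ t z2)//; last 2 first.
  - by rewrite tz2.
  - exact: sub.
  rewrite (@integ_eq_cst _ 0 t z2)//; last 2 first.
  - exact: sub.
  - move=> u /andP[tu uz2] /=; have u0 : 0 <= u by rewrite (le_trans t0) ?ltW.
    rewrite /r c00 subr0 clip_id ?subrr//.
    rewrite (le_trans d0)/=; last first.
      by apply: dm => //; rewrite (le_trans (ltW uz2)).
    by rewrite -[P]add0r -c00; apply: ltz2; rewrite u0.
  rewrite mul0r add0r (le_trans (high z2 _)) ?lexx//.
  by apply: hm; lra.
have [z1 /andP[z10 z1T] [ltz1 gtz1]] := @level_crossing T d c T0 dm.
(* Before [z1] the store idles, so all of [E] is spent after [t] and cancels the term [E]. *)
have low t : 0 <= t <= z1 -> integ t T (d \- r) <= h (T - t).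
  move=> /andP[t0 tz1]; have tT := le_trans tz1 z1T.
  have -> : integ t T (d \- r) = integ t T d - E.
    rewrite gE ?t0// -wE (@integ_cat _ 0 t T r) ?t0//.
    rewrite (@integ_eq_cst _ 0 0 t)// ?mul0r ?add0r//; first exact: sub.
    move=> u /andP[u0 ut]; apply: clip_neg => //; rewrite subr_le0.
    by apply: ltz1; rewrite ltW//= (lt_le_trans ut).
  by rewrite lerBlDl dhE ?t0.
move=> t /andP[t0 tT].
have [z2t|tz2] := leP z2 t; first by apply: high; rewrite z2t.
have [tz1|z1t] := leP t z1; first by apply: low; rewrite t0.
(* Between the crossings the residual is the constant [c], so its integral over [[t, T]] is affine
   in [t]. *)
have gc (a b : R) : z1 <= a -> a <= b -> b <= z2 ->
    integ a b (d \- r) = c * (b - a).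
  move=> z1a ab bz2; apply: integ_eq_cst => //.
    by apply: sub => //; [exact: le_trans z1a | exact: le_trans z2T].
  move=> u /andP[au ub] /=; have uT : u <= T by lra.
  have u0 : 0 <= u by lra.
  rewrite /r clip_id; first by rewrite opprB addrC subrK.
  rewrite subr_ge0 lerBlDl gtz1 ?ltz2 ?u0 ?uT ?andbT//=; lra.
have Hz1 := low z1; have Hz2 := high z2.
rewrite z10 lexx/= in Hz1; rewrite lexx z2T/= in Hz2.
move: (Hz1 isT) (Hz2 isT) => {Hz1 Hz2}.
have z1z2 := lt_trans z1t tz2.
have lez1z2 := ltW z1z2; have letz2 := ltW tz2; have lez1t := ltW z1t.
rewrite (@integ_cat _ z1 z2 T) ?lez1z2//; last exact: sub.
rewrite (@integ_cat _ t z2 T) ?letz2//; last exact: sub.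
rewrite (gc z1 z2)// (gc t z2)//; set G := integ z2 T _ => H1 H2.
(* The bounds at [z1] and [z2] interpolate to [t], once multiplied by [z2 - z1] to match the
   division-free form of concavity. *)
have := hc (T - z2) (T - t) (T - z1).
have -> : T - z1 - (T - t) = t - z1 by ring.
have -> : T - t - (T - z2) = z2 - t by ring.
have -> : T - z1 - (T - z2) = z2 - z1 by ring.
move=> Hc; rewrite -(@ler_pM2l _ (z2 - z1)) ?subr_gt0//.
apply: le_trans (Hc _ _ _ _); try lra.
have -> : (z2 - z1) * (c * (z2 - t) + G) =
    (t - z1) * G + (z2 - t) * (c * (z2 - z1) + G) by ring.
by rewrite lerD// ler_wpM2l// subr_ge0.
Qed.

End Slice.

(** * Joint output of a list of stores, and sufficiency of the output bound *)

Section Hall.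
Context {R : realType} {I : Type}.
Implicit Types (s : seq I) (E P : I -> R) (T x : R).

Definition max_output s E P x := \sum_(i <- s) Num.min (E i) (P i * x).

Lemma max_output_nondecr s E P T : (forall i, 0 <= P i) ->
  nondecr_on T (max_output s E P).
Proof.
move=> P0 x y _ xy _; apply: ler_sum => i _.
by rewrite le_min !ge_min lexx/= ler_wpM2l ?orbT.
Qed.

(** Each summand is the smaller of two affine functions; the one attained at [y] dominates the
    summand at [x] and at [z]. *)
Lemma max_output_concave s E P T : concave_on T (max_output s E P).
Proof.
move=> x y z _ xy yz _; rewrite /max_output !mulr_sumr -big_split/=.
apply: ler_sum => i _.
have m1 w : Num.min (E i) (P i * w) <= E i by rewrite ge_min lexx.
have m2 w : Num.min (E i) (P i * w) <= P i * w by rewrite ge_min lexx orbT.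
rewrite [in leRHS]minEle; case: ifP => _.
  have -> : (z - x) * E i = (z - y) * E i + (y - x) * E i by ring.
  by rewrite lerD// ler_wpM2l ?subr_ge0.
have -> : (z - x) * (P i * y) = (z - y) * (P i * x) + (y - x) * (P i * z) by ring.
by rewrite lerD// ler_wpM2l ?subr_ge0.
Qed.

End Hall.

(** Equality stops short of [T]: the integral conditions do not see the value [d T], so only the
    inequality that a policy requires is claimed there. *)
Lemma exists_discharge (R : realType) (I : eqType) (s : seq I) (E P : I -> R)
    (T : R) (d : R -> R) :
    uniq s -> 0 <= T -> (forall i, 0 <= E i) -> (forall i, 0 <= P i) ->
    nondecr_on T d -> 0 <= d 0 -> integrable_on 0 T d ->
    (forall t, 0 <= t <= T -> integ t T d <= max_output s E P (T - t)) ->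
  exists r : I -> R -> R,
    [/\ forall i, integrable_on 0 T (r i), forall i t, 0 <= r i t <= P i,
        forall i, integ 0 T (r i) <= E i,
        forall t, 0 <= t <= T -> \sum_(i <- s) r i t <= d t &
        forall t, 0 <= t < T -> \sum_(i <- s) r i t = d t].
Proof.
move=> + T0 E0 P0.
elim: s d => [|a s IHs] d /=.
  move=> _ dm d0 di dh; exists (fun _ => cst 0); split=> //.
  - by move=> i; exact: integrable_on_cst.
  - by move=> i t; rewrite lexx P0.
  - by move=> i; rewrite integ_cst// mul0r.
  - by move=> t /andP[t0 tT]; rewrite big_nil (le_trans d0)//; exact: dm.
  (* With no stores the integral over [[t, T]] is at most [0], yet [d] stays above [d t] there;
     since [t < T], this forces [d t = 0]. *)
  - move=> t /andP[t0 tT]; rewrite big_nil; apply/eqP; rewrite eq_le.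
    rewrite (le_trans d0) ?dm//=; last exact: ltW.
    have /dh : 0 <= t <= T by rewrite t0 ltW.
    rewrite /max_output big_nil; have [//|dt] := leP (d t) 0.
    have : d t * (T - t) <= integ t T d.
      apply: integ_ge_cst; [exact: ltW | exact: integrable_on_sub di |].
      by move=> u /andP[tu uT]; exact: dm.
    by have : 0 < d t * (T - t) by [rewrite mulr_gt0// subr_gt0]; lra.
move=> /andP[as_ us] dm d0 di dh.
have [|||c c0 [rE gh]] := @slice _ T d (P a) (E a) (max_output s E P)
  T0 (P0 a) (E0 a) dm d0 di.
- exact: max_output_nondecr.
- exact: max_output_concave.
- by move=> t /dh; rewrite /max_output big_cons.
set ra := (fun t => clip _ _) in rE gh.
have rai : integrable_on 0 T ra by exact: integrable_clip.
have gd t : (d \- ra) t = d t - ra t by [].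
have [||||r [ri rP rE' rd rde]] := IHs (d \- ra) us.
- move=> x y x0 xy yT; have := dm _ _ x0 xy yT; rewrite !gd /ra.
  have := @clip_le1 _ (P a) (d x - c) (d y - c); lra.
- rewrite gd subr_ge0; apply: clip_le_id => //; lra.
- exact: integrable_onB.
- exact: gh.
(* By uniqueness [a] is not in [s], so redefining the rate of [a] leaves the sum over [s]
   unchanged. *)
have sumE t : \sum_(i <- a :: s) (if i == a then ra t else r i t) =
    ra t + \sum_(i <- s) r i t.
  rewrite big_cons eqxx; congr (_ + _); apply: eq_big_seq => i si.
  by case: eqP => // ia; move: as_; rewrite -ia si.
exists (fun i t => if i == a then ra t else r i t); split.
- by move=> i; case: eqP => // _; exact: ri.
- by move=> i t; case: eqP => // ->; rewrite clip_ge0// clip_le.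
- by move=> i; case: eqP => // ->.
- by move=> t /rd; rewrite gd sumE lerBrDl.
- by move=> t /rde; rewrite gd sumE => ->; rewrite addrC subrK.
Qed.

(** * Upper bounds on what a cross-charging policy can deliver *)

Section Necessity.
Context {R : realType} {S : finType}.
Variables (Ebar P P' eta E0 : S -> R) (T : R) (d : R -> R) (r : S -> R -> R).
Hypotheses (hP : forall i, 0 < P i) (hP' : forall i, 0 <= P' i).
Hypothesis heta : forall i, 0 < eta i <= 1.
Hypothesis hpol : policy Ebar P P' eta E0 T d r.

(** Charging losses only reduce the supply: dividing a negative rate by [eta i <= 1] cannot increase
    it. *)
Lemma supplied_le_sum t : supplied eta r t <= \sum_i r i t.
Proof.
apply: ler_sum => i _; case: ifPn => //; rewrite -ltNge => ri0.
have /andP[e0 e1] := heta i.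
by rewrite ler_pdivrMr// ler_niMr// ltW.
Qed.

Lemma policy_integrable i : integrable_on 0 T (r i).
Proof.
case: hpol => mr hr; apply: (integrable_on_bounded (P i + P' i)) => //.
move=> t /hr[/(_ i)[_ /andP[Pr rP]] _].
by have := hP i; have := hP' i; lra.
Qed.

Lemma demand_le_output (t : R) :
  integrable_on 0 T d -> completely_serves eta T d r -> 0 <= t <= T ->
  integ t T d <= \sum_i Num.min (energy E0 r i t) (P i * (T - t)).
Proof.
move=> di hs /andP[t0 tT]; case: (hpol) => _ hr.
have ri i : integrable_on t T (r i).
  exact: integrable_on_sub (policy_integrable i).
have si : integrable_on t T (fun u => \sum_i r i u) by exact: integrable_on_sum.
have {}di : integrable_on t T d by exact: integrable_on_sub di.
have md : measurable_fun `[t, T] d.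
  by apply/measurable_EFinP; exact: measurable_int di.
have ms : measurable_fun `[t, T] (fun u => \sum_i r i u).
  by apply/measurable_EFinP; exact: measurable_int si.
(* The demand is below the total rate only almost everywhere. The function [m] is below it
   everywhere and has the same integral as [d], so pointwise comparison applies. *)
pose m := d \min (fun u => \sum_i r i u).
have mm : measurable_fun `[t, T] m by exact: measurable_minr.
have dm : {ae mu, forall u : R, u \in `[t, T] -> (d u)%:E = (m u)%:E}.
  move: hs; apply: filterS; first exact: (ae_filter_ringOfSetsType mu).
  move=> u hu; rewrite in_itv/= => /andP[tu uT].
  rewrite /m /= min_l// -hu ?(le_trans t0 tu)//.
  exact: supplied_le_sum.
have mi : integrable_on t T m.
  apply: (integrable_on_bounded (\sum_i P i)) => // u /andP[tu uT].
  have /hr[ru /andP[s0 sd]] : 0 <= u <= T by rewrite uT (le_trans t0).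
  have sP : \sum_i r i u <= \sum_i P i.
    by apply: ler_sum => i _; case: (ru i) => _ /andP[].
  rewrite /m /= ge_min sP orbT andbT.
  have := supplied_le_sum u; rewrite le_min; lra.
have -> : integ t T d = integ t T m.
  by congr fine; apply: ae_eq_integral => //; exact/measurable_EFinP.
have : integ t T m <= integ t T (fun u => \sum_i r i u).
  by apply: le_integ => // u _; rewrite /m /= ge_min lexx orbT.
move=> /le_trans; apply; rewrite integ_sum//; apply: ler_sum => i _.
(* The first bound holds because the energy left at [T] is nonnegative, the second by the rate
   limit. *)
rewrite le_min; apply/andP; split.
  have /hr[/(_ i)[/andP[+ _] _] _] : 0 <= T <= T by rewrite lexx (le_trans t0).
  rewrite /energy (@integ_cat _ 0 t T) ?t0//; last exact: policy_integrable.
  by lra.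
apply: integ_le_cst => // u /andP[tu uT].
by have /hr[/(_ i)[_ /andP[]] _] : 0 <= u <= T by rewrite uT (le_trans t0).
Qed.

End Necessity.

Lemma served_le_max_output (R : realType) (S : finType)
    (Ebar P P' eta E0 : S -> R) (T : R) (d : R -> R) (r : S -> R -> R) :
    (forall i, 0 < P i) -> (forall i, 0 <= P' i) ->
    (forall i, 0 < eta i <= 1) -> (forall i, 0 <= E0 i <= Ebar i) ->
    nondecr_on T d -> integrable_on 0 T d -> kS Ebar P E0 <= d 0 ->
    policy Ebar P P' eta E0 T d r -> completely_serves eta T d r ->
  forall t, 0 <= t <= T ->
    integ t T d <= max_output (index_enum S) E0 P (T - t).
Proof.
move=> hP hP' heta hE0 dm di hk hpol hs t tT; have /andP[t0 tT'] := tT.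
have := demand_le_output _ _ _ _ _ _ _ _ hP hP' heta hpol.
move=> /(_ _ di hs) dle.
have [su|us] := leP (T - t)%:E (u0 Ebar P E0).
  (* Initially full stores hold at most [Ebar i <= E0 i] at time [t]; for the others, [u0] makes the
     rate term at most [E0 i]. *)
  apply: le_trans (dle t tT) _; apply: ler_sum => i _.
  have [/(_ i)[/andP[_ eE] _] _] := hpol.2 t tT.
  rewrite le_min !ge_min lexx orbT andbT.
  have [iS|EE] := ltP (E0 i) (Ebar i); last by rewrite (le_trans eE).
  suff -> : P i * (T - t) <= E0 i by rewrite orbT.
  rewrite mulrC -ler_pdivlMr// -lee_fin (le_trans su)//.
  by apply: bigmin_le_cond; rewrite inE.
have T0 := le_trans t0 tT'.
have d0T : integ 0 T d <= max_output (index_enum S) E0 P T.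
  have := dle 0; rewrite lexx T0 => /(_ isT)/le_trans; apply.
  by apply: ler_sum => i _; rewrite /energy integ_point !subr0.
have k0t : kS Ebar P E0 * t <= integ 0 t d.
  rewrite -[X in _ * X]subr0; apply: integ_ge_cst => //.
    exact: integrable_on_sub di.
  move=> u /andP[v0 ut]; rewrite (le_trans hk)//.
  by apply: dm => //; exact: le_trans tT'.
(* Shortening the horizon by [t] costs at most [P i * t] per store of [S2] and nothing for [S1],
   whose terms are already capped by [E0 i]. *)
suff : max_output (index_enum S) E0 P T <=
    max_output (index_enum S) E0 P (T - t) + kS Ebar P E0 * t.
  by move: d0T; rewrite (integ_cat 0 t T)//; lra.
rewrite /kS big_mkcond/= mulr_suml -big_split/=; apply: ler_sum => i _.
rewrite !inE; case: (leP _ (u0 _ _ _)) => [iu|_] /=.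
  have Es : Ebar i < P i * (T - t).
    by rewrite mulrC -ltr_pdivrMr// -lte_fin (le_lt_trans iu).
  have /andP[_ EE] := hE0 i.
  by rewrite mul0r addr0 le_min ge_min lexx/= ge_min (le_trans EE (ltW Es)).
rewrite -lerBlDr le_min !lerBlDr !ge_min -mulrDr subrK lexx orbT andbT.
by rewrite lerDl mulr_ge0// ltW.
Qed.

(** * From the output bound to a policy without cross-charging *)

Theorem theorem4 (R : realType) (S : finType)
  (Ebar P P' eta E0 : S -> R)
  (hEbar : forall i, 0 < Ebar i) (hP : forall i, 0 < P i)
  (hP' : forall i, 0 <= P' i) (heta : forall i, 0 < eta i <= 1)
  (hE0 : forall i, 0 <= E0 i <= Ebar i)
  (T : R) (hT : 0 < T) (d : R -> R)
  (hd0 : forall t, 0 <= t <= T -> 0 <= d t)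
  (hdint : lebesgue_measure.-integrable `[0, T] (EFin \o d))
  (hdmono : forall s t, 0 <= s -> s <= t -> t <= T -> d s <= d t)
  (hdk : kS Ebar P E0 <= d 0) :
  (exists r : S -> R -> R,
     policy Ebar P P' eta E0 T d r /\ completely_serves eta T d r) ->
  exists r : S -> R -> R,
    policy Ebar P P' eta E0 T d r /\ completely_serves eta T d r /\
    no_cross_charging T r.
Proof.
move=> [q [qpol qs]].
have T0 := ltW hT.
have [||||||||r [ri rP rE rd rde]] :=
  exists_discharge _ _ (index_enum S) E0 P T d.
- exact: index_enum_uniq.
- by [].
- by move=> i; case/andP: (hE0 i).
- by move=> i; exact: ltW.
- exact: hdmono.
- by apply: hd0; rewrite lexx.
- exact: hdint.
- exact: (served_le_max_output _ _ _ _ _ _ _ _ _ q hP hP' heta hE0).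
have supE t : supplied eta r t = \sum_i r i t.
  by apply: eq_bigr => i _; case/andP: (rP i t) => ->.
exists r; split; [split|split].
- by move=> i; apply/measurable_EFinP; exact: measurable_int (ri i).
- move=> t /andP[t0 tT]; rewrite supE rd ?t0// sumr_ge0; last first.
    by move=> i _; case/andP: (rP i t).
  split=> // i; split; last first.
    by case/andP: (rP i t) => r0 ->; rewrite (le_trans _ r0)// oppr_le0.
  have int_ge0 a b : 0 <= integ a b (r i).
    by apply: Rintegral_ge0 => u _; case/andP: (rP i u).
  have /andP[_ EE] := hE0 i.
  rewrite /energy subr_ge0 lerBlDr (le_trans EE) ?lerDl ?int_ge0// andbT.
  by apply: le_trans (rE i); rewrite (integ_cat 0 t T) ?t0// lerDl int_ge0.
(* The constructed rates match [d] on [[0, T[], so the exceptional null set is the single point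
   [T]. *)
- exists [set T]; split=> [||t /=]; first exact: measurable_set1.
    exact: lebesgue_measure_set1.
  apply: contra_notP => tT /andP[t0 tT']; rewrite supE rde// t0 lt_neqAle tT'.
  by rewrite andbT; apply/eqP.
- by move=> i t _; case/andP: (rP i t).
Qed.
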